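(* Let $\mathbf{x}_1,\dots,\mathbf{x}_N$ be the vertices of the mesh with associated real values $u_1,\dots,u_N$, and let $\beta\in[1,2]$ be the limiter parameter. Assume that $u_i>0$ for all $i=1,\dots,N$. Then for every pair of adjacent control volumes $V_i,V_j$ (sharing the edge/face $\sigma=\partial V_i\cap\partial V_j$) the mobilities reconstructed by the multislope method are positive: $$u_{i\rightarrow j}>0\quad\text{and}\quad u_{j\rightarrow i}>0 .$$
   Context: Mesh: $\Omega\subset\mathbb{R}^d$ ($d=2,3$) is a polygonal/polyhedral domain with distinct points (vertices) $\mathbf{x}_1,\dots,\mathbf{x}_N$ of a Delaunay mesh (triangles if $d=2$, tetrahedra if $d=3$) and the dual Voronoi control volumes $V_i=\{\mathbf{y}\in\Omega: |\mathbf{x}_i-\mathbf{y}|<|\mathbf{x}_j-\mathbf{y}|\ \forall j\ne i\}$. $\mathcal{W}_i$ denotes the set of vertices $\mathbf{x}_j$ ($j\neq i$) with $\partial V_j\cap\partial V_i\ne\emptyset$. $|\mathbf{x}\mathbf{y}|$ is the length of the segment from $\mathbf{x}$ to $\mathbf{y}$. Multislope reconstruction at the midpoint of $\mathbf{x}_i\mathbf{x}_j$: Choose $\mathbf{x}_{k_1}\in\mathcal{W}_i$ maximizing, over $\mathbf{x}_q\in\mathcal{W}_i$, the cosine of the angle between $\overrightarrow{\mathbf{x}_q\mathbf{x}_i}$ and $\overrightarrow{\mathbf{x}_i\mathbf{x}_j}$. For $r=0,1,2,\dots$ let $\mathbf{x}^{\rm ext}_{ij}=\frac{(2^r+1)\mathbf{x}_i-\mathbf{x}_j}{2^r}$,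 and take the first $r$ for which $\mathbf{x}^{\rm ext}_{ij}$ lies in a triangle (tetrahedron) of the Delaunay mesh having $\mathbf{x}_{k_1}\mathbf{x}_i$ as an edge. Let $u^{\rm ext}_{ij}\in\mathbb{R}$ be the value at $\mathbf{x}^{\rm ext}_{ij}$ obtained by interpolating the values of $u$ at the vertices of that triangle (tetrahedron). The point $\mathbf{x}^{\rm ext}_{ji}$ and value $u^{\rm ext}_{ji}$ are defined in the same way with $i$ and $j$ exchanged. Define the slopes $$s^+_{ij}=\frac{u_j-u_i}{|\mathbf{x}_i\mathbf{x}_j|},\quad s^-_{ij}=\frac{u_i-u^{\rm ext}_{ij}}{|\mathbf{x}_i\mathbf{x}^{\rm ext}_{ij}|},\quad s^+_{ji}=\frac{u_i-u_j}{|\mathbf{x}_i\mathbf{x}_j|},\quad s^-_{ji}=\frac{u_j-u^{\rm ext}_{ji}}{|\mathbf{x}^{\rm ext}_{ji}\mathbf{x}_j|},$$ and $$u_{i\rightarrow j}=u_i+\frac{|\mathbf{x}_i\mathbf{x}_j|}{2}\phi(s^+_{ij},s^-_{ij}),\qquad u_{j\rightarrow i}=u_j+\frac{|\mathbf{x}_i\mathbf{x}_j|}{2}\phi(s^+_{ji},s^-_{ji}),$$ where $\phi(s^+,s^-)=\mathrm{minmod}\left(\beta s^+,\beta s^-,\frac{s^++s^-}{2}\right)$ and $\mathrm{minmod}(q_1,q_2,q_3)=k\min_{1\le r\le 3}|q_r|$ if $\mathrm{sign}(q_1)=\mathrm{sign}(q_2)=\mathrm{sign}(q_3)=k$, and $\mathrm{minmod}(q_1,q_2,q_3)=0$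 otherwise. *)

(* Defs.v *)
From HB Require Import structures.
From mathcomp Require Import all_boot all_order all_algebra.
From mathcomp Require Import all_classical all_reals all_analysis.

Set Implicit Arguments.
Unset Strict Implicit.
Unset Printing Implicit Defensive.

Import Order.TTheory GRing.Theory Num.Theory.
Import numFieldNormedType.Exports.

Local Open Scope classical_set_scope.
Local Open Scope ring_scope.

Section Geometry.
Variables (R : realType) (d : nat).
Implicit Types (v w y : 'rV[R]_d) (A : set 'rV[R]_d).

(* The library norm on ['rV[R]_d] is the sup norm, hence the explicit
   Euclidean structure; the topology is the same. *)
Definition dotp v w : R := \sum_(k < d) v ord0 k * w ord0 k.
Definition enorm v : R := Num.sqrt (dotp v v).
Definition edist v w : R := enorm (v - w).
Definition cos_angle v w : R := dotp v w / (enorm v * enorm w).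

Definition boundary A : set 'rV[R]_d := closure A `\` A°.

Section Simplices.
Variables (I : finType) (p : I -> 'rV[R]_d).
Implicit Types (S : {set I}) (a : I -> R).

Definition affinely_independent S : Prop :=
  forall a, \sum_(k in S) a k = 0 -> \sum_(k in S) a k *: p k = 0 ->
    forall k, k \in S -> a k = 0.

Definition barycentric S y a : Prop :=
  [/\ forall k, k \in S -> 0 <= a k,
      \sum_(k in S) a k = 1 &
      \sum_(k in S) a k *: p k = y].

(* The closed simplex (convex hull) spanned by the points [p k], [k \in S]. *)
Definition simplex S : set 'rV[R]_d := [set y | exists a, barycentric S y a].

End Simplices.

(* A nondegenerate closed simplex of dimension [d - 1]. *)
Definition is_facet A : Prop :=
  exists p : 'I_d -> 'rV[R]_d,
    affinely_independent p [set: 'I_d]%SET /\ A = simplex p [set: 'I_d]%SET.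

(* Polygonal domain for [d = 2], polyhedral domain for [d = 3]. Connected
   does not entail simply connected, and [Omega] need not be convex. *)
Record polyhedral_domain (Omega : set 'rV[R]_d) : Prop := PolyhedralDomain {
  domain_nonempty : Omega !=set0;
  domain_open : open Omega;
  domain_connected : connected Omega;
  domain_bounded : exists M : R, forall y, Omega y -> enorm y <= M;
  domain_boundary : exists (m : nat) (F : 'I_m -> set 'rV[R]_d),
    (forall k, is_facet (F k)) /\ boundary Omega = \bigcup_(k in [set: 'I_m]) F k
}.

End Geometry.

Section Mesh.
Variables (R : realType) (d N : nat) (Omega : set 'rV[R]_d).
Variables (x : 'I_N -> 'rV[R]_d) (T : {set {set 'I_N}}).
Implicit Types (i j k q : 'I_N) (S : {set 'I_N}) (r : nat).

(* Cells are recorded by their sets of vertex indices. *)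
Record delaunay_mesh : Prop := DelaunayMesh {
  mesh_vertices_distinct : injective x;
  mesh_card : forall S, S \in T -> #|S| = d.+1;
  mesh_nondegenerate : forall S, S \in T -> affinely_independent x S;
  mesh_cover : closure Omega = \bigcup_(S in [set` T]) simplex x S;
  mesh_conforming : forall S S', S \in T -> S' \in T ->
    simplex x S `&` simplex x S' = simplex x (S :&: S')%SET;
  mesh_vertices_used : forall i, exists2 S, S \in T & i \in S;
  (* the open circumball of a cell contains no mesh vertex *)
  mesh_delaunay : forall S, S \in T -> exists (c : 'rV[R]_d) (rho : R),
    (forall k, k \in S -> edist (x k) c = rho) /\
    (forall k, rho <= edist (x k) c)
}.

Definition voronoi i : set 'rV[R]_d :=
  [set y | Omega y /\ forall j, j != i -> edist (x i) y < edist (x j) y].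

Definition interface i j : set 'rV[R]_d :=
  boundary (voronoi i) `&` boundary (voronoi j).

Definition neighbors i : set 'I_N :=
  [set j | j != i /\ interface i j !=set0].

(* The common boundary is an edge/face, not merely a set of smaller
   dimension: it contains a nondegenerate [(d-1)]-simplex. *)
Definition adjacent_volumes i j : Prop :=
  i != j /\ exists2 F, is_facet F & F `<=` interface i j.

Definition upwind_neighbor i j k : Prop :=
  neighbors i k /\
  forall q, neighbors i q ->
    cos_angle (x i - x q) (x j - x i) <= cos_angle (x i - x k) (x j - x i).

Definition ext_point i j r : 'rV[R]_d :=
  (2 ^+ r)^-1 *: ((2 ^+ r + 1) *: x i - x j).

Definition ext_cell i j k r S : Prop :=
  [/\ S \in T, k \in S, i \in S & simplex x S (ext_point i j r)].

(* [xe] and [ue] are an extrapolation point and the value there. This is a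
   relation: the maximizer [k] and the cell [S] need not be unique, and near
   the boundary of the domain there may be no admissible [r] at all. *)
Definition extrapolation (u : 'I_N -> R) i j (xe : 'rV[R]_d) (ue : R) : Prop :=
  exists k r S (a : 'I_N -> R),
    [/\ upwind_neighbor i j k,
        ext_cell i j k r S,
        forall r' S', (r' < r)%N -> ~ ext_cell i j k r' S',
        xe = ext_point i j r &
        barycentric x S xe a /\ ue = \sum_(l in S) a l * u l].

End Mesh.

Section Limiter.
Variable R : realType.
Implicit Types q s beta : R.

Definition minmod q1 q2 q3 : R :=
  if (Num.sg q1 == Num.sg q2) && (Num.sg q2 == Num.sg q3)
  then Num.sg q1 * Num.min `|q1| (Num.min `|q2| `|q3|)
  else 0.

Definition limiter beta sp sm : R :=
  minmod (beta * sp) (beta * sm) ((sp + sm) / 2).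

End Limiter.

(* [m] is a value of the mobility reconstructed at the midpoint of
   [x i], [x j] from the side of [i]. *)
Definition multislope (R : realType) (d N : nat) (Omega : set 'rV[R]_d)
    (x : 'I_N -> 'rV[R]_d) (T : {set {set 'I_N}}) (beta : R) (u : 'I_N -> R)
    (i j : 'I_N) (m : R) : Prop :=
  exists (xe : 'rV[R]_d) (ue : R),
    extrapolation Omega x T u i j xe ue /\
    let splus := (u j - u i) / edist (x i) (x j) in
    let sminus := (u i - ue) / edist (x i) xe in
    m = u i + edist (x i) (x j) / 2 * limiter beta splus sminus.

(* Main.v *)
Require Import Defs.
From HB Require Import structures.
From mathcomp Require Import all_boot all_order all_algebra.
From mathcomp Require Import all_classical all_reals all_analysis.
From mathcomp Require Import ring lra.

Set Implicit Arguments.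
Unset Strict Implicit.
Unset Printing Implicit Defensive.

Import Order.TTheory GRing.Theory Num.Theory.

Local Open Scope classical_set_scope.
Local Open Scope ring_scope.

(** At the midpoint, the correction that is added to [u i] is [h / 2] times the
    limited slope, with [h] the distance between the two vertices. Minmod
    returns a value between zero and each of its arguments, so the limited slope
    lies between zero and [beta] times the forward slope [(u j - u i) / h], and
    the correction lies between zero and [beta / 2 * (u j - u i)]. As
    [0 <= beta / 2 <= 1], the reconstructed value is at least the smaller of
    [u i] and [u j], which is positive ([limited_value_ge]). *)

Lemma minmod_ge_min (R : realType) (q1 q2 q3 : R) :
  Num.min 0 q1 <= minmod q1 q2 q3.
Proof.
rewrite /minmod; case: ifP => _; last by rewrite ge_min lexx.
set m := Num.min `|q1| _.
have m_ge0 : 0 <= m by rewrite !le_min !normr_ge0.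
have m_le : m <= `|q1| by rewrite ge_min lexx.
case: (ltrgt0P q1) m_le => [q1_gt0|q1_lt0|->] m_le.
- by rewrite gtr0_sg // mul1r.
- by rewrite ltr0_sg // mulN1r lerNr.
- by rewrite sgr0 mul0r.
Qed.

(** The bound [beta <= 2] is what keeps the midpoint value from undershooting
    [b]: half of [beta] times the jump [b - a] is at most the whole jump. *)
Lemma limited_value_ge (R : realType) (beta a b h sm : R) :
  0 <= beta <= 2 -> 0 <= h ->
  Num.min a b <= a + h / 2 * limiter beta ((b - a) / h) sm.
Proof.
move=> /andP[beta_ge0 beta_le2]; rewrite le0r => /predU1P[->|h_gt0].
  by rewrite !mul0r addr0 ge_min lexx.
have h2_ge0 : 0 <= h / 2 by rewrite divr_ge0 // ltW.
have := minmod_ge_min (beta * ((b - a) / h)) (beta * sm) (((b - a) / h + sm) / 2).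
rewrite -/(limiter _ _ _) => /(ler_wpM2l h2_ge0).
set corr := h / 2 * limiter _ _ _.
rewrite minr_pMr // mulr0.
have -> : h / 2 * (beta * ((b - a) / h)) = beta / 2 * (b - a).
  by field; rewrite gt_eqF.
rewrite !ge_min => /orP[corr_ge0|corr_ge].
  by rewrite lerDl corr_ge0.
by apply/orP; have [ab|ba] := leP a b; [left|right]; nra.
Qed.

Lemma multislope_gt0 (R : realType) (d N : nat) (Omega : set 'rV[R]_d)
    (x : 'I_N -> 'rV[R]_d) (T : {set {set 'I_N}}) (beta : R) (u : 'I_N -> R)
    (i j : 'I_N) (m : R) :
  0 <= beta <= 2 -> 0 < u i -> 0 < u j ->
  multislope Omega x T beta u i j m -> 0 < m.
Proof.
move=> hbeta ui_gt0 uj_gt0 [xe [ue [_ ->]]].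
apply: lt_le_trans (limited_value_ge _ _ _ hbeta (sqrtr_ge0 _)).
by rewrite lt_min ui_gt0.
Qed.

Theorem lemma3p1 (R : realType) (d : nat) (hd : d = 2%N \/ d = 3%N) (N : nat)
    (Omega : set 'rV[R]_d) (x : 'I_N -> 'rV[R]_d) (T : {set {set 'I_N}})
    (hOmega : polyhedral_domain Omega) (hT : delaunay_mesh Omega x T)
    (beta : R) (hbeta : 1 <= beta <= 2)
    (u : 'I_N -> R) (hu : forall i, 0 < u i) :
  forall i j : 'I_N, adjacent_volumes Omega x i j ->
    (forall uij : R, multislope Omega x T beta u i j uij -> 0 < uij) /\
    (forall uji : R, multislope Omega x T beta u j i uji -> 0 < uji).
Proof.
move=> i j _.
have beta02 : 0 <= beta <= 2.
  by case/andP: hbeta => beta_ge1 ->; rewrite (le_trans ler01).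
by split=> m; apply: multislope_gt0.
Qed.
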